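(* Let $T\ge 2$. Assume that the data $X_0,\ldots,X_T$, $F_1,\ldots,F_T$ of problem (P) (see context) satisfy (A0)--(A3). Let FDDP be run on (P) with tolerance $\bar\varepsilon>0$ and an initial point $(x_1^0,\ldots,x_T^0)\in X_1\times\cdots\times X_T$. Define $$\overline r := 2\sum_{t=2}^T U_t-\sum_{t=1}^{T-1}L_t ,\qquad \overline Q:=40\sum_{t=1}^{T-1}\frac{M_t^2}{\mu_t},$$ where $U_t\ge 0$ is an upper bound for $F_t$ on the compact set $X_t\times X_{t-1}$ and $L_t<0$ is a lower bound on $X_t$ for the initial lower approximation $\Gamma_t^1$ built by FDDP. Then the number of iterations performed by FDDP until it obtains a $\bar\varepsilon$-solution of (P), i.e., a tuple $y^k=(y_1^k,\ldots,y_T^k)\in X_1\times\cdots\times X_T$ satisfying $p_0^k\le\bar\varepsilon$, is bounded by $$\left(1+\left[\max\left(2,\frac{\overline Q}{\bar\varepsilon}\right)\right]^{2^{T-1}-1}\right)\log\left(\frac{2\overline r}{\bar\varepsilon}\right)+1 .$$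
   Context: **Problem.** $T$ is the number of stages, $x_0\in\mathbb R^{n_0}$ is fixed, and (P) is $\min_{(x_1,\ldots,x_T)\in X_1\times\cdots\times X_T}\sum_{t=1}^T F_t(x_t,x_{t-1})$. Assumptions, for every $t=1,\ldots,T$: (A0) $X_0=\{x_0\}$ and $X_t\subset\mathbb R^{n_t}$ is nonempty, convex, compact; (A1) $F_t:\mathbb R^{n_t}\times\mathbb R^{n_{t-1}}\to\mathbb R$ is convex (jointly) and finite everywhere; (A2) there is $\mu_t>0$ such that $F_t(\cdot,x_{t-1})$ is $\mu_t$-strongly convex for every $x_{t-1}\in X_{t-1}$; (A3) there is $M_{t-1}\ge0$ such that for every $(x_t,x_{t-1})\in X_t\times X_{t-1}$ every subgradient at $x_{t-1}$ of the convex function $F_t(x_t,\cdot)$ on $\mathbb R^{n_{t-1}}$ has Euclidean norm at most $M_{t-1}$. Here $\Psi$ is $\mu$-strongly convex if $\Psi(\alpha z+(1-\alpha)z')\le\alpha\Psi(z)+(1-\alpha)\Psi(z')-\frac{\alpha(1-\alpha)\mu}{2}\|z-z'\|^2$ for all $z,z'$ and $\alpha\in[0,1]$. **Functions.** $G_{t-1}(u_t,\ldots,u_T;u_{t-1})=\sum_{s=t}^T F_s(u_s,u_{s-1})$. $\mathcal Q_T\equiv0$ on $X_T$, and for $t=1,\ldots,T$, $\mathcal Q_{t-1}(x_{t-1})=\min_{(u_t,\ldots,u_T)\in X_t\times\cdots\times X_T}G_{t-1}(u_t,\ldots,u_T;x_{t-1})$ for $x_{t-1}\in X_{t-1}$;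 thus $\mathcal Q_0(x_0)$ is the optimal value of (P). For a convex lower semicontinuous real-valued $\Gamma_t$ on $X_t$, $\mathcal V_{t-1}(x_{t-1};\Gamma_t)=\min_{u_t\in X_t}F_t(u_t,x_{t-1})+\Gamma_t(u_t)$, a convex function of $x_{t-1}\in\mathbb R^{n_{t-1}}$. $\mathcal B_{X_t}(\mathcal Q_t)$ is the set of convex lower semicontinuous functions on $X_t$ that minorize $\mathcal Q_t$ on $X_t$. **Shadow.** Given $x_{t-1}$ and $\Gamma_t$, let $x_t$ be the minimizer of $F_t(\cdot,x_{t-1})+\Gamma_t$ over $X_t$. A function $\overline\Gamma_t\in\mathcal B_{X_t}(\mathcal Q_t)$ is a shadow of $\Gamma_t$ if $\overline\Gamma_t(x_t)=\Gamma_t(x_t)$ and $x_t=\operatorname{argmin}_{u_t\in X_t}F_t(u_t,x_{t-1})+\overline\Gamma_t(u_t)$. **FDDP.** Inputs: $\bar\varepsilon>0$, $(x_1^0,\ldots,x_T^0)\in X_1\times\cdots\times X_T$. Step 1. Set $k=1$, $y^0=(x_1^0,\ldots,x_T^0)$, $\Gamma_T^1\equiv0$. For $t=T-1,\ldots,1$ choose a subgradient $s_t^0$ of $\mathcal V_t(\cdot;\Gamma_{t+1}^1)$ at $x_t^0$ and set $\Gamma_t^1(\cdot)=\mathcal V_t(x_t^0;\Gamma_{t+1}^1)+\langle s_t^0,\cdot-x_t^0\rangle$. Step 2. With $x_0^k=x_0$, for $t=1,\ldots,T$ compute $x_t^k=\operatorname{argmin}_{u_t\in X_t}F_t(u_t,x_{t-1}^k)+\Gamma_t^k(u_t)$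 and the corresponding optimal value $m_{t-1}^k$. Set $x^k=(x_1^k,\ldots,x_T^k)$; set $y^k=y^{k-1}$ if $G_0(y^{k-1};x_0)\le G_0(x^k;x_0)$, and $y^k=x^k$ otherwise. Step 3. Compute $p_0^k=G_0(y^k;x_0)-m_0^k$. If $p_0^k\le\bar\varepsilon$, stop and output $y^k$; else go to Step 4. Step 4. Set $\Gamma_T^{k+1}\equiv0$. For $t=T-1,\ldots,1$, let $\overline\Gamma_t^k$ be any shadow of $\Gamma_t^k$ (with respect to $x_{t-1}^k$, so that the minimizer is $x_t^k$), choose a subgradient $s_t^k$ of $\mathcal V_t(\cdot;\Gamma_{t+1}^{k+1})$ at $x_t^k$, and set $\ell_t^{k+1}(\cdot)=\mathcal V_t(x_t^k;\Gamma_{t+1}^{k+1})+\langle s_t^k,\cdot-x_t^k\rangle$ and $\Gamma_t^{k+1}=\max\{\ell_t^{k+1},\overline\Gamma_t^k\}$. Replace $k$ by $k+1$ and go to Step 2.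
   Formalization: The logarithm in the bound is replaced by its positive part max(0, log(2r̄/ε̄)), since for ε̄ > 2r̄ the printed bound is below 1 although at least one iteration is always performed. *)

(* Defs.v *)
From HB Require Import structures.
From mathcomp Require Import all_boot all_order all_algebra.
From mathcomp Require Import all_classical all_reals all_analysis.

Set Implicit Arguments.
Unset Strict Implicit.
Unset Printing Implicit Defensive.

Import Order.TTheory GRing.Theory Num.Theory numFieldNormedType.Exports.

Local Open Scope classical_set_scope.
Local Open Scope ring_scope.

Section Euclidean.
Context {R : realType} {d : nat}.
Implicit Types (u v z s : 'rV[R]_d) (f : 'rV[R]_d -> R) (A : set 'rV[R]_d).

Definition dotv u v : R := \sum_(i < d) u 0 i * v 0 i.

(* The library norm on ['rV[R]_d] is the sup norm. *)
Definition enorm u : R := Num.sqrt (dotv u u).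

Definition strongly_convex (mu : R) f : Prop :=
  forall z z' (a : R), 0 <= a <= 1 ->
    f (a *: z + (1 - a) *: z')
      <= a * f z + (1 - a) * f z'
         - a * (1 - a) * mu / 2 * enorm (z - z') ^+ 2.

Definition subgradient f z s : Prop :=
  forall z', f z + dotv s (z' - z) <= f z'.

Definition argmin A f : set 'rV[R]_d :=
  [set u | A u /\ forall v, A v -> f u <= f v].

(* Semicontinuity for the topology induced on [A]. *)
Definition lsc_on A f : Prop :=
  @lower_semicontinuous (subspace A) R (fun u => (f u)%:E).

End Euclidean.

(* Data of the problem: [F t] is the cost F_t(x_t, x_{t-1}) of stage t, for
   1 <= t <= T; the component [F 0] is never used.  Functions Gamma_t on X_t are
   total functions whose values outside [X t] are irrelevant.  Tuples are
   families over all of [nat]; the components beyond T are irrelevant. *)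
Section FDDP.
Context {R : realType} (T : nat) {n : nat -> nat}.
Context (X : forall t, set 'rV[R]_(n t)).
Context (F : forall t, 'rV[R]_(n t) -> 'rV[R]_(n t.-1) -> R).
Local Arguments X : clear implicits.
Local Arguments F : clear implicits.

(* G_t(u_{t+1}, ..., u_T; u_t) *)
Definition cost_from (t : nat) (u : forall s, 'rV[R]_(n s)) : R :=
  \sum_(t.+1 <= s < T.+1) F s (u s) (u s.-1).

(* Under the standing assumptions the infima below are minima.  For t = T the
   sum is empty, so that the value is 0. *)
Definition cost_to_go (t : nat) (v : 'rV[R]_(n t)) : R :=
  inf [set cost_from t u | u in
    [set u : forall s, 'rV[R]_(n s) |
      u t = v /\ forall s, (t < s <= T)%N -> X s (u s)]].

(* V_t(v; g), where g is a function on X_{t+1} *)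
Definition approx_value (t : nat) (g : 'rV[R]_(n t.+1) -> R)
    (v : 'rV[R]_(n t)) : R :=
  inf [set F t.+1 u v + g u | u in X t.+1].

(* The set B_{X_t}(Q_t) *)
Definition lower_approx (t : nat) : set ('rV[R]_(n t) -> R) :=
  [set g | [/\ convex_function (X t) g, lsc_on (X t) g &
              forall u, X t u -> g u <= cost_to_go u]].

Definition stage_obj (t : nat) (v : 'rV[R]_(n t.-1)) (g : 'rV[R]_(n t) -> R)
    (u : 'rV[R]_(n t)) : R := F t u v + g u.

(* [gbar] is a shadow of [g] at [v], the minimizer for [g] being [xt] *)
Definition is_shadow (t : nat) (v : 'rV[R]_(n t.-1)) (xt : 'rV[R]_(n t))
    (g gbar : 'rV[R]_(n t) -> R) : Prop :=
  [/\ argmin (X t) (stage_obj v g) xt,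
      lower_approx gbar,
      gbar xt = g xt &
      argmin (X t) (stage_obj v gbar) xt].

(* [l] is a linearization of V_t(.; g) at [v] *)
Definition is_cut (t : nat) (g : 'rV[R]_(n t.+1) -> R) (v : 'rV[R]_(n t))
    (l : 'rV[R]_(n t) -> R) : Prop :=
  exists2 s, subgradient (approx_value g) v s &
    forall u, l u = approx_value g v + dotv s (u - v).

Section Run.
Context (x0 : 'rV[R]_(n 0)) (eps : R).
(* [x k], [y k] are the tuples x^k, y^k, whose components of index 0 are both
   x_0; [Gam k t] is Gamma_t^k. *)
Context (x y : nat -> forall t, 'rV[R]_(n t)).
Context (Gam : nat -> forall t, 'rV[R]_(n t) -> R).
Local Arguments Gam : clear implicits.

(* p_0^k = G_0(y^k; x_0) - m_0^k *)
Definition gap (k : nat) : R :=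
  cost_from 0 (y k) - approx_value (Gam k 1%N) x0.

(* Iteration k takes place: the stopping test failed at all earlier ones. *)
Definition performed (k : nat) : Prop :=
  (0 < k)%N /\ forall j, (0 < j < k)%N -> eps < gap j.

Definition fddp_init : Prop :=
  [/\ x 0%N 0%N = x0 /\ (forall t, (0 < t <= T)%N -> X t (x 0%N t)),
      y 0%N = x 0%N,
      (forall u, X T u -> Gam 1%N T u = 0) &
      forall t, (0 < t < T)%N -> is_cut (Gam 1%N t.+1) (x 0%N t) (Gam 1%N t)].

Definition fddp_forward (k : nat) : Prop :=
  [/\ x k 0%N = x0,
      (forall t, (0 < t <= T)%N ->
        argmin (X t) (stage_obj (x k t.-1) (Gam k t)) (x k t)) &
      y k = if cost_from 0 (y k.-1) <= cost_from 0 (x k) then y k.-1 else x k].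

Definition fddp_backward (k : nat) : Prop :=
  (forall u, X T u -> Gam k.+1 T u = 0) /\
  forall t, (0 < t < T)%N ->
    exists l gbar : 'rV[R]_(n t) -> R,
      [/\ is_cut (Gam k.+1 t.+1) (x k t) l,
          is_shadow (x k t.-1) (x k t) (Gam k t) gbar &
          forall u, X t u -> Gam k.+1 t u = Num.max (l u) (gbar u)].

(* A complete run: nothing is required of the iterates that follow the stop. *)
Definition fddp_run : Prop :=
  fddp_init /\
  forall k, performed k ->
    fddp_forward k /\ (eps < gap k -> fddp_backward k).

End Run.
End FDDP.

(* Main.v *)
Require Import Defs.
From HB Require Import structures.
From mathcomp Require Import all_boot all_order all_algebra.
From mathcomp Require Import all_classical all_reals all_analysis.
From mathcomp Require Import ring lra.

Set Implicit Arguments.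
Unset Strict Implicit.
Unset Printing Implicit Defensive.

Import Order.TTheory GRing.Theory Num.Theory numFieldNormedType.Exports.

Local Open Scope classical_set_scope.
Local Open Scope ring_scope.

(* Write D_t = G_t - m_t for the gap of stage t at an iterate and d_t for the
   distance between consecutive iterates at stage t.  The cuts give
   D_{t-1} <= D_t + 2 M_t d_t with D_{T-1} = 0, and strong convexity together
   with the shadow property gives
   m_{t-1}^{k+1} >= m_{t-1}^k + mu_t d_t^2 / 2 - M_{t-1} d_{t-1}.
   Let B_t be the running average
   B_t^{k+1} = (1 - a) (B_t^k + M_t d_t) + a G_t^{k+1}, so that
   P_t = B_t - m_t >= 0 and P_0 dominates the stopping gap.  A sum of the P_t
   with doubly exponentially decaying weights and a = 1 / A,
   A = 1 + q^(2^(T-1) - 1), q = max(2, Qbar / eps), lets the quadratic terms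
   absorb the linear ones and contracts by the factor 1 - 1/A up to an error
   7 eps / (25 A), starting below rbar. *)

(** * The Euclidean inner product and norm *)

Section Euclid.
Context {R : realType} {d : nat}.
Implicit Types (u v w z s : 'rV[R]_d) (f h : 'rV[R]_d -> R).

Lemma dotvC u v : dotv u v = dotv v u.
Proof. by apply: eq_bigr => i _; rewrite mulrC. Qed.

Lemma dotvDr u v w : dotv u (v + w) = dotv u v + dotv u w.
Proof.
by rewrite /dotv -big_split; apply: eq_bigr => i _; rewrite mxE mulrDr.
Qed.

Lemma dotvZr a u v : dotv u (a *: v) = a * dotv u v.
Proof.
by rewrite /dotv big_distrr; apply: eq_bigr => i _; rewrite mxE mulrCA.
Qed.

Lemma dotvDl u v w : dotv (u + v) w = dotv u w + dotv v w.
Proof. by rewrite ![dotv _ w]dotvC dotvDr. Qed.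

Lemma dotvZl a u v : dotv (a *: u) v = a * dotv u v.
Proof. by rewrite ![dotv _ v]dotvC dotvZr. Qed.

Lemma dotvNr u v : dotv u (- v) = - dotv u v.
Proof. by rewrite -scaleN1r dotvZr mulN1r. Qed.

Lemma dotvNl u v : dotv (- u) v = - dotv u v.
Proof. by rewrite ![dotv _ v]dotvC dotvNr. Qed.

Lemma dotv_delta i u : dotv (delta_mx 0 i) u = u 0 i.
Proof.
rewrite /dotv (bigD1 i)//= mxE !eqxx mul1r big1 ?addr0// => j ji.
by rewrite mxE eqxx (negbTE ji) mul0r.
Qed.

Lemma dotvv_ge0 u : 0 <= dotv u u.
Proof. by apply: sumr_ge0 => i _; rewrite -expr2 sqr_ge0. Qed.

Lemma enorm_ge0 u : 0 <= enorm u.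
Proof. exact: sqrtr_ge0. Qed.

Lemma sqr_enorm u : enorm u ^+ 2 = dotv u u.
Proof. by rewrite sqr_sqrtr// dotvv_ge0. Qed.

Lemma enormN u : enorm (- u) = enorm u.
Proof. by rewrite /enorm dotvNl dotvNr opprK. Qed.

Lemma enorm0 : enorm (0 : 'rV[R]_d) = 0.
Proof. by rewrite /enorm /dotv big1 ?sqrtr0// => i _; rewrite mxE mul0r. Qed.

Lemma enorm_eq0 u : enorm u = 0 -> u = 0.
Proof.
move=> u0; have : dotv u u = 0 by rewrite -sqr_enorm u0 expr0n.
move=> /eqP; rewrite psumr_eq0 => [/allP uu|i _]; last by rewrite -expr2 sqr_ge0.
apply/rowP => i; rewrite mxE; apply/eqP; rewrite -sqrf_eq0 expr2.
by apply: uu; rewrite mem_index_enum.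
Qed.

(** Cauchy-Schwarz: expand the square of [enorm v *: u - enorm u *: v] and cancel the factor
    [enorm u * enorm v]. *)
Lemma dotv_le_enorm u v : dotv u v <= enorm u * enorm v.
Proof.
have [/enorm_eq0->|u0] := eqVneq (enorm u) 0.
  by rewrite enorm0 mul0r /dotv big1// => i _; rewrite mxE mul0r.
have [/enorm_eq0->|v0] := eqVneq (enorm v) 0.
  by rewrite enorm0 mulr0 /dotv big1// => i _; rewrite mxE mulr0.
have uv : 0 < enorm u * enorm v.
  by rewrite mulr_gt0// lt_neqAle eq_sym ?u0 ?v0 enorm_ge0.
have := dotvv_ge0 (enorm v *: u - enorm u *: v).
rewrite dotvDl !dotvDr !dotvNl !dotvNr !dotvZl !dotvZr -!sqr_enorm.
rewrite (dotvC v u) => h.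
by rewrite -(ler_pM2l uv); nra.
Qed.

End Euclid.

(** * Subgradients of finite convex functions *)

Section Subgradient.
Context {R : realType} {d : nat}.
Implicit Types (u v w z s : 'rV[R]_d) (f h : 'rV[R]_d -> R).

Definition convex_ineq f := forall u v (a : R), 0 <= a <= 1 ->
  f (a *: u + (1 - a) *: v) <= a * f u + (1 - a) * f v.

(** A flag of coordinate subspaces: [lead 0] is trivial and [lead d] is the whole space. *)
Let lead k : set 'rV[R]_d := [set u | forall i : 'I_d, (k <= i)%N -> u 0 i = 0].

(* One step of the Hahn-Banach extension, from [lead i] to [lead i.+1]. *)
Let extend_minorant h s (i : 'I_d) : convex_ineq h ->
  (forall u, lead i u -> dotv s u <= h u) ->
  exists s', forall u, lead i.+1 u -> dotv s' u <= h u.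
Proof.
move=> ch sh; pose e : 'rV[R]_d := delta_mx 0 i.
(* The lower bounds that the points [v - b *: e] impose on the slope along [e]; the points
   [v + a *: e] impose the upper bounds of [up]. *)
pose lo := [set c | exists v (b : R), [/\ lead i v, 0 < b &
  c = (dotv s v - h (v - b *: e)) / b]].
have lead0 : lead i 0 by move=> j _; rewrite mxE.
have up v (a c : R) : lead i v -> 0 < a -> lo c -> c <= (h (v + a *: e) - dotv s v) / a.
  move=> lv a0 [w [b [lw b0 ->]]].
  have ab : 0 < a + b by rewrite addr_gt0.
  have abn : a + b != 0 by rewrite gt_eqF.
  (* With this weight the components along [e] cancel, and the combination falls into [lead i],
     where [s] minorizes [h]. *)
  have l01 : 0 <= b / (a + b) <= 1.
    by rewrite divr_ge0 ?(ltW b0) ?(ltW ab)//= ler_pdivrMr// mul1r lerDr ltW.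
  have := ch (v + a *: e) (w - b *: e) _ l01.
  have -> : (b / (a + b)) *: (v + a *: e) + (1 - b / (a + b)) *: (w - b *: e)
            = (b / (a + b)) *: v + (a / (a + b)) *: w.
    by apply/rowP => j; rewrite !mxE; field.
  have lvw : lead i ((b / (a + b)) *: v + (a / (a + b)) *: w).
    by move=> j ij; rewrite !mxE lv// lw// !mulr0 addr0.
  move=> /(le_trans (sh _ lvw)); rewrite dotvDr !dotvZr.
  rewrite -(ler_pM2r ab).
  have -> : (b / (a + b) * dotv s v + a / (a + b) * dotv s w) * (a + b)
    = b * dotv s v + a * dotv s w by field.
  have -> : (b / (a + b) * h (v + a *: e) + (1 - b / (a + b)) * h (w - b *: e)) * (a + b)
    = b * h (v + a *: e) + a * h (w - b *: e) by field.
  by move=> ?; rewrite ler_pdivrMr// mulrAC ler_pdivlMr//; lra.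
have lo0 : lo ((dotv s 0 - h (0 - 1 *: e)) / 1) by exists 0, 1; split.
have lo_sup : has_sup lo.
  split; first by eexists; exact: lo0.
  by exists ((h (0 + 1 *: e) - dotv s 0) / 1) => c; apply: up.
exists (s + (sup lo - s 0 i) *: e) => u lu.
have lv : lead i (u - u 0 i *: e).
  move=> j; rewrite !mxE leq_eqVlt => /predU1P[/val_inj<-|ij].
    by rewrite !eqxx mulr1 subrr.
  have -> : (j == i) = false by rewrite -val_eqE gtn_eqF.
  by rewrite (lu j ij) andbF mulr0 subr0.
have -> : dotv (s + (sup lo - s 0 i) *: e) u
    = dotv s (u - u 0 i *: e) + u 0 i * sup lo.
  rewrite dotvDl dotvZl dotv_delta dotvDr dotvNr dotvZr (dotvC s e) dotv_delta.
  ring.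
have [u0|u0|u0] := ltgtP (u 0 i) 0.
- have b0 : 0 < - u 0 i by rewrite oppr_gt0.
  have : (dotv s (u - u 0 i *: e) - h u) / (- u 0 i) <= sup lo.
    apply: ub_le_sup; first by case: lo_sup.
    exists (u - u 0 i *: e), (- u 0 i); split => //.
    by rewrite scaleNr opprK subrK.
  by rewrite ler_pdivrMr// => ?; lra.
- have : sup lo <= (h u - dotv s (u - u 0 i *: e)) / u 0 i.
    apply: ge_sup; first by case: lo_sup.
    move=> c /(up _ _ _ lv u0); by rewrite subrK.
  by rewrite ler_pdivlMr// => ?; lra.
- by rewrite u0 scale0r subr0 mul0r addr0 sh// -[u]subr0 -(scale0r e) -u0.
Qed.

(** The zero functional on [lead 0], where [h] vanishes, is extended below [h] one coordinate at a
    time. *)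
Lemma subgradient_ex f z : convex_ineq f -> exists s, subgradient f z s.
Proof.
move=> cf; pose h u := f (z + u) - f z.
have ch : convex_ineq h.
  move=> u v a a01; rewrite /h.
  have -> : z + (a *: u + (1 - a) *: v) = a *: (z + u) + (1 - a) *: (z + v).
    by apply/rowP => j; rewrite !mxE; ring.
  have := cf (z + u) (z + v) a a01; lra.
have [s sh] : exists s, forall u, lead d u -> dotv s u <= h u.
  have : forall k, (k <= d)%N -> exists s, forall u, lead k u -> dotv s u <= h u.
    elim=> [_|k IH kd].
      exists 0 => u u0; suff -> : u = 0.
        by rewrite /h addr0 subrr -(scale0r 0) dotvZl mul0r.
      by apply/rowP => i; rewrite mxE u0.
    have [s hs] := IH (ltnW kd).
    exact: (@extend_minorant h s (Ordinal kd)).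
  by apply.
exists s => w; have := sh (w - z); rewrite /h (addrC z) subrK lerBrDl.
by apply => i; rewrite leqNgt ltn_ord.
Qed.

End Subgradient.

Lemma convex_function_le {R : realType} {E : lmodType R} (A : set E)
    (f : E -> R) u v (a : R) :
  convex_function A f -> A u -> A v -> 0 <= a <= 1 ->
  f (a *: u + (1 - a) *: v) <= a * f u + (1 - a) * f v.
Proof.
move=> cf Au Av /andP[a0 a1].
by have /= := cf (Itv01 a0 a1) u v (mem_set Au) (mem_set Av).
Qed.

Lemma convex_set_mem {R : realType} {E : lmodType R} (A : set E) u v (a : R) :
  convex_set A -> A u -> A v -> 0 <= a <= 1 -> A (a *: u + (1 - a) *: v).
Proof.
move=> cA Au Av /andP[a0 a1].
by have /set_mem := cA u v (Itv01 a0 a1) (mem_set Au) (mem_set Av).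
Qed.

Lemma continuous_sum {R : realType} {T : topologicalType} (I : Type) (r : seq I)
    (f : I -> T -> R) :
  (forall i, continuous (f i)) -> continuous (fun x => \sum_(i <- r) f i x).
Proof.
move=> cf; elim: r => [|i r IH] x.
  rewrite (_ : (fun _ => _) = cst 0); first exact: cvg_cst.
  by apply/funext => y; rewrite big_nil.
rewrite (_ : (fun _ => _) = fun y => f i y + \sum_(j <- r) f j y); last first.
  by apply/funext => y; rewrite big_cons.
by apply: cvgD; [exact: cf|exact: IH].
Qed.

(** * Lower semicontinuity, minimizers and growth estimates *)

Section LowerSemicontinuity.
Context {R : realType} {d : nat}.
Implicit Types (u v s : 'rV[R]_d) (f g : 'rV[R]_d -> R) (A : set 'rV[R]_d).

Lemma lsc_onP A f : lsc_on A f <-> forall u a, A u -> a < f u ->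
  exists2 V, nbhs u V & forall v, V v -> A v -> a < f v.
Proof.
split=> [lf u a Au afu|lf u a].
  have [|V] := lf u a; first by rewrite lte_fin.
  rewrite {1}/nbhs/= -nbhs_subspace_in// => nV Vf.
  exists [set v | A v -> V v] => // v /[apply] /Vf.
  by rewrite lte_fin.
rewrite lte_fin => afu; have [Au|nAu] := pselect (A u).
  have [V nV Vf] := lf u a Au afu.
  exists (V `&` A); last by move=> v [Vv Av]; rewrite lte_fin; exact: Vf.
  by rewrite {1}/nbhs/= -nbhs_subspace_in//; apply: filterS nV => v Vv Av.
(* A point outside [A] is isolated in the subspace topology. *)
exists [set u]; last by move=> _ ->; rewrite lte_fin.
by rewrite {1}/nbhs/= -nbhs_subspace_out.
Qed.

Lemma lsc_on_eq A f g : (forall u, A u -> f u = g u) -> lsc_on A f -> lsc_on A g.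
Proof.
move=> fg /lsc_onP lf; apply/lsc_onP => u a Au.
rewrite -fg// => /(lf _ _ Au)[V nV Vf].
by exists V => // v Vv Av; rewrite -fg//; exact: Vf.
Qed.

Lemma lsc_onD A f g : lsc_on A f -> lsc_on A g ->
  lsc_on A (fun u => f u + g u).
Proof.
move=> /lsc_onP lf /lsc_onP lg; apply/lsc_onP => u a Au afg.
pose e := (f u + g u - a) / 2.
have e0 : 0 < e by rewrite divr_gt0// subr_gt0.
have [|V nV Vf] := lf u (f u - e) Au; first by rewrite gtrBl.
have [|W nW Wg] := lg u (g u - e) Au; first by rewrite gtrBl.
exists (V `&` W); first exact: filterI.
move=> v [Vv Wv] Av; have := Vf v Vv Av; have := Wg v Wv Av.
by rewrite /e; lra.
Qed.

Lemma lsc_on_max A f g : lsc_on A f -> lsc_on A g ->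
  lsc_on A (fun u => Num.max (f u) (g u)).
Proof.
move=> /lsc_onP lf /lsc_onP lg; apply/lsc_onP => u a Au.
rewrite lt_max => /orP[/(lf _ _ Au)|/(lg _ _ Au)] [V nV Vf].
  by exists V => // v Vv Av; rewrite lt_max Vf.
by exists V => // v Vv Av; rewrite lt_max Vf// orbT.
Qed.

Lemma continuous_lsc_on A f : continuous f -> lsc_on A f.
Proof.
move=> cf; apply/lsc_onP => u a _ afu.
exists [set v | a < f v] => //.
apply: (cf u [set r | a < r]); exact: lt_nbhsr.
Qed.

Lemma dotv_continuous s : continuous (dotv s).
Proof.
by apply: continuous_sum => i u; exact: (cvgM (cvg_cst _) (@coord_continuous _ _ _ _ _ _)).
Qed.

Lemma subr_continuous v : continuous (fun u => u - v).
Proof. by move=> u; exact: (cvgB cvg_id (cvg_cst _)). Qed.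

(** At each point a subgradient gives a continuous affine minorant that touches [f] there. *)
Lemma convex_lsc_on A f : convex_ineq f -> lsc_on A f.
Proof.
move=> cf; apply/lsc_onP => u a Au afu.
have [s hs] := subgradient_ex u cf.
have /lsc_onP/(_ u a) : lsc_on A (fun v => f u + dotv s (v - u)).
  have cs : continuous (fun v => dotv s (v - u)).
    move=> v; apply: (@continuous_comp _ _ _ (fun v => v - u) (dotv s)).
      exact: subr_continuous.
    exact: dotv_continuous.
  by apply: continuous_lsc_on => v; exact: (cvgD (cvg_cst _) (cs v)).
have -> : f u + dotv s (u - u) = f u.
  by rewrite subrr -(scale0r 0) dotvZr mul0r addr0.
move=> /(_ Au afu)[V nV Vf]; exists V => // v Vv Av.
exact: lt_le_trans (Vf v Vv Av) (hs v).
Qed.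

(** The sublevel sets [S v] are nested and generate a proper filter; by semicontinuity its cluster
    point in [A] belongs to all of them. *)
Lemma lsc_argmin A f : compact A -> A !=set0 -> lsc_on A f ->
  exists u, argmin A f u.
Proof.
move=> cA [u0 Au0] /lsc_onP lf.
pose S v := [set u | A u /\ f u <= f v].
pose G : set_system _ := filter_from A S.
have GP : ProperFilter G.
  apply: filter_from_proper; last by move=> v Av; exists v.
  apply: filter_from_filter; first by exists u0.
  move=> v w Av Aw; have [vw|wv] := leP (f v) (f w).
    by exists v => // u [Au uv]; split; split=> //; exact: le_trans vw.
  by exists w => // u [Au uw]; split; split=> //; apply: le_trans (ltW wv).
have GA : G A by exists u0 => // u [].
have [p [Ap clp]] := cA G GP GA.
exists p; split=> // v Av; rewrite leNgt; apply/negP => vp.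
have [V nV Vf] := lf p _ Ap vp.
have GS : G (S v) by exists v.
have [q [[Aq qv] Vq]] := clp _ _ GS nV.
by have := Vf q Vq Aq; rewrite ltNge qv.
Qed.

Lemma enorm_continuous : continuous (@enorm R d).
Proof.
move=> u; apply: continuous_comp; last exact: sqrt_continuous.
apply: continuous_sum => i v.
exact: (cvgM (@coord_continuous _ _ _ _ _ _) (@coord_continuous _ _ _ _ _ _)).
Qed.

Lemma compact_enorm_bounded A v : compact A ->
  exists C, forall u, A u -> enorm (u - v) <= C.
Proof.
move=> cA; have [A0|nA0] := pselect (A !=set0); last first.
  by exists 0 => u Au; exfalso; apply: nA0; exists u.
have [|u [Au hu]] := @lsc_argmin A (fun u => - enorm (u - v)) cA A0.
  have cn : continuous (fun u => enorm (u - v)).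
    move=> u; apply: (@continuous_comp _ _ _ (fun u => u - v) (@enorm R d)).
      exact: subr_continuous.
    exact: enorm_continuous.
  by apply: continuous_lsc_on => u; exact: (cvgN (cn u)).
by exists (enorm (u - v)) => w Aw; rewrite -lerN2; exact: hu.
Qed.

(** Comparing [u] with [a *: v + (1 - a) *: u] and dividing by [a] gives the estimate up to a factor
    [1 - a] on the quadratic term. *)
Lemma argmin_growth A f g mu u v : convex_set A -> strongly_convex mu f ->
  convex_function A g -> argmin A (fun z => f z + g z) u -> A v ->
  f u + g u + mu / 2 * enorm (v - u) ^+ 2 <= f v + g v.
Proof.
move=> cA sf cg [Au mu_u] Av; set N := enorm (v - u) ^+ 2.
pose c := mu / 2 * N; rewrite -/c; pose D := f v + g v - (f u + g u).
have D0 : 0 <= D by rewrite subr_ge0 mu_u.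
have key a : 0 < a -> a <= 1 -> (1 - a) * c <= D.
  move=> a0 a1; have a01 : 0 <= a <= 1 by rewrite ltW.
  have := mu_u _ (convex_set_mem cA Av Au a01).
  have := sf v u a a01; have := convex_function_le cg Av Au a01.
  rewrite -/N => h1 h2 h3; rewrite -(ler_pM2l a0) /c /D.
  by have /= := le_trans h3 (lerD h2 h1); lra.
suff : c <= D by rewrite /D; lra.
move: c D D0 key => c D D0 key.
rewrite leNgt; apply/negP => Dc; have c0 : 0 < c by exact: le_lt_trans D0 Dc.
(* This replaces the limit of [a] to 0: when [D < c], this value makes the left side of [key] equal
   to [(c + D) / 2], which exceeds [D]. *)
have := key ((c - D) / (2 * c)).
have -> : (1 - (c - D) / (2 * c)) * c = (c + D) / 2 by field; rewrite gt_eqF.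
have h0 : 0 < (c - D) / (2 * c) by rewrite divr_gt0 ?subr_gt0// mulr_gt0.
have h1 : (c - D) / (2 * c) <= 1 by rewrite ler_pdivrMr ?mulr_gt0//; lra.
by move=> /(_ h0 h1); lra.
Qed.

Lemma subgradient_lipschitz A f (M : R) u v : convex_ineq f ->
  (forall w s, A w -> subgradient f w s -> enorm s <= M) -> A u ->
  f u <= f v + M * enorm (v - u).
Proof.
move=> cf hM Au; have [s hs] := subgradient_ex u cf.
have := hs v; have := dotv_le_enorm s (u - v).
rewrite -opprB dotvNr enormN => h1 h2.
have := ler_wpM2r (enorm_ge0 (v - u)) (hM u s Au hs).
by lra.
Qed.

End LowerSemicontinuity.

(** * Doubly exponential stage weights *)

Section Weights.
Context {R : realType} (N : nat) (q : R).

(* The exponents are chosen so that [bot * weight i = q * weight i.+1 ^+ 2] and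
   [weight 0 = 1]. *)
Definition bot : R := q ^- (2 ^ N - 1).
Definition weight (i : nat) : R := bot * q ^+ (2 ^ (N - i) - 1).

Context (q2 : 2 <= q).

Let q0 : 0 < q. Proof. by apply: lt_le_trans q2. Qed.

Lemma bot_gt0 : 0 < bot.
Proof. by rewrite invr_gt0 exprn_gt0. Qed.

Lemma weight_gt0 i : 0 < weight i.
Proof. by rewrite mulr_gt0 ?bot_gt0 ?exprn_gt0. Qed.

Lemma weight0 : weight 0 = 1.
Proof. by rewrite /weight subn0 mulVf// gt_eqF ?exprn_gt0. Qed.

Lemma bot_le_weight i : bot <= weight i.
Proof.
by rewrite ler_peMr ?(ltW bot_gt0)// exprn_ege1//; apply: le_trans q2; lra.
Qed.

Lemma weight_le1 i : weight i <= 1.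
Proof.
rewrite -weight0 ler_pM2l ?bot_gt0// ler_weXn2l//; last first.
  by apply: leq_sub2r; rewrite leq_exp2l// leq_sub2l.
by apply: le_trans q2; lra.
Qed.

(** The exponent at [i] is twice the exponent at [i.+1], plus one. *)
Lemma weight_rec i : (i < N)%N -> bot * weight i = q * weight i.+1 ^+ 2.
Proof.
move=> iN; rewrite /weight.
have -> : (N - i = (N - i.+1).+1)%N by rewrite subnSK.
set p := (2 ^ (N - i.+1))%N.
have -> : (2 ^ (N - i.+1).+1 - 1 = ((p - 1) * 2).+1)%N.
  have : (0 < p)%N by rewrite expn_gt0.
  by rewrite expnS -/p; case: p => // p _; rewrite mulnC mulSn subn1/= subn1.
by rewrite exprS exprM; ring.
Qed.

(** Before index [N] the weights fall by a factor of at least [q ^+ 2], hence 4, at each step. The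
    sum stops there because the last ratio is only [q]. *)
Lemma sum_weight_le s : (s <= N)%N -> \sum_(0 <= i < s) weight i <= 4 / 3.
Proof.
case: s => [|s] sN; first by rewrite big_nil; lra.
suff : \sum_(0 <= i < s.+1) weight i <= 4 / 3 - weight s / 3.
  by have := weight_gt0 s; lra.
elim: s sN => [|s IH] sN; first by rewrite big_nat1 weight0; lra.
rewrite big_nat_recr//=; have := IH (ltnW sN).
suff : 4 * weight s.+1 <= weight s by lra.
have qw : q * bot <= weight s.+1.
  rewrite /weight [q * _]mulrC ler_pM2l ?bot_gt0// -[leLHS]expr1 ler_weXn2l//.
    by apply: le_trans q2; lra.
  by rewrite subn_gt0 -[1%N](expn0 2) ltn_exp2l// subn_gt0.
rewrite -(ler_pM2l bot_gt0) weight_rec; last exact: ltnW.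
have := ler_wpM2r (ltW (mulr_gt0 q0 (weight_gt0 s.+1))) qw.
have : 4 * (bot * weight s.+1) <= q * q * (bot * weight s.+1).
  rewrite ler_pM2r; last exact: mulr_gt0 bot_gt0 (weight_gt0 _).
  by have := q2; nra.
by move=> h1 h2; lra.
Qed.

(* Summation by parts moves the linear terms in [d] next to the strong convexity
   terms [d ^+ 2], which absorb them by AM-GM. *)
Lemma weighted_gap_step (P P' D d M mu : nat -> R) (eps : R) :
  d 0%N = 0 -> (forall i, 0 <= d i) ->
  (forall i, (i <= N)%N -> 0 <= M i) ->
  (forall i, (0 < i <= N.+1)%N -> 0 < mu i) ->
  40 * \sum_(1 <= i < N.+1) (M i ^+ 2 / mu i) <= q * eps ->
  (forall i, (i < N)%N -> D i <= D i.+1 + 2 * M i.+1 * d i.+1) -> D N <= 0 ->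
  let A := 1 + bot^-1 in
  (forall i, (i <= N)%N -> P' i <=
    (1 - A^-1) * (P i - mu i.+1 / 2 * d i.+1 ^+ 2 + 2 * M i * d i)
    + A^-1 * D i) ->
  \sum_(0 <= i < N.+1) weight i * P' i <=
    (1 - A^-1) * (\sum_(0 <= i < N.+1) weight i * P i)
    + A^-1 * (7 / 25 * eps).
Proof.
move=> d0 d_ge0 M0 mu0 Qeps DS DN A PP'.
have b0 := bot_gt0; have A0 : 0 < A by rewrite addr_gt0// invr_gt0.
pose th := 1 - A^-1.
(* This identity lets [th] be factored out, so that the terms in [D] enter with the small
   coefficient [bot]. *)
have thE : A^-1 = th * bot.
  by rewrite /th /A; field; rewrite gt_eqF//= gt_eqF// addr_gt0.
have th0 : 0 < th by rewrite -(pmulr_lgt0 _ b0) -thE invr_gt0.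
(* Each [D i] is pushed up to stage [j] through [DS]; the increment at [i.+1] thus collects the
   weights of all stages up to [i]. *)
have abel j : (j <= N)%N -> \sum_(0 <= i < j) weight i * D i <=
    (\sum_(0 <= i < j) weight i) * D j +
    \sum_(0 <= i < j) (\sum_(0 <= l < i.+1) weight l) * (2 * M i.+1 * d i.+1).
  elim: j => [_|j IH jN]; first by rewrite !big_nil mul0r addr0.
  rewrite ![\sum_(0 <= i < j.+1) _](big_nat_recr j)//=.
  have := IH (ltnW jN); set S := \sum_(0 <= i < j) weight i.
  move=> h.
  have Sw : 0 <= S + weight j.
    by rewrite addr_ge0 ?(ltW (weight_gt0 j))// sumr_ge0// => i _; rewrite ltW ?weight_gt0.
  by have := ler_wpM2l Sw (DS j jN); lra.
have sumD : \sum_(0 <= i < N.+1) weight i * D i <=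
    \sum_(0 <= i < N) 4 / 3 * (2 * M i.+1 * d i.+1).
  rewrite big_nat_recr//=; have := abel N (leqnn N); set S := \sum_(0 <= i < N) weight i.
  have : (S + weight N) * D N <= 0.
    rewrite mulr_ge0_le0// addr_ge0 ?(ltW (weight_gt0 N))// sumr_ge0// => i _.
    by rewrite ltW ?weight_gt0.
  suff : \sum_(0 <= i < N) (\sum_(0 <= l < i.+1) weight l) * (2 * M i.+1 * d i.+1)
    <= \sum_(0 <= i < N) 4 / 3 * (2 * M i.+1 * d i.+1) by lra.
  rewrite !big_nat; apply: ler_sum => i /andP[_ iN]; apply: ler_wpM2r.
    by rewrite !mulr_ge0// M0.
  exact: sum_weight_le.
have sumM : \sum_(0 <= i < N.+1) weight i * (2 * M i * d i) =
    \sum_(0 <= i < N) weight i.+1 * (2 * M i.+1 * d i.+1).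
  by rewrite big_nat_recl//= d0 !mulr0 add0r.
have summu : \sum_(0 <= i < N) weight i * (mu i.+1 / 2 * d i.+1 ^+ 2) <=
    \sum_(0 <= i < N.+1) weight i * (mu i.+1 / 2 * d i.+1 ^+ 2).
  rewrite big_nat_recr//= lerDl mulr_ge0 ?(ltW (weight_gt0 N))//.
  by rewrite mulr_ge0 ?sqr_ge0// divr_ge0// ltW// mu0/=.
(* As [bot <= weight i.+1], the linear coefficient is at most 8/3 + 2 = 14/3 times
   [weight i.+1 * M i.+1]. Completing the square yields 98/9 = (14/3)^2 / 2, and [weight_rec] turns
   [weight i.+1 ^+ 2 / weight i] into [bot / q]. *)
have stage i : (i < N)%N ->
    bot * (4 / 3 * (2 * M i.+1 * d i.+1)) + weight i.+1 * (2 * M i.+1 * d i.+1)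
      - weight i * (mu i.+1 / 2 * d i.+1 ^+ 2)
    <= 98 / 9 * (bot / q) * (M i.+1 ^+ 2 / mu i.+1).
  move=> iN; have w0 := weight_gt0 i; have v0 := weight_gt0 i.+1.
  have m0 : 0 < mu i.+1 by rewrite mu0//= ltnW.
  have Md : 0 <= M i.+1 * d i.+1 by rewrite mulr_ge0// M0.
  have := ler_wpM2r Md (bot_le_weight i.+1); have wr := weight_rec iN.
  have -> : 98 / 9 * (bot / q) * (M i.+1 ^+ 2 / mu i.+1) =
     98 / 9 * weight i.+1 ^+ 2 * M i.+1 ^+ 2 / (weight i * mu i.+1).
    have -> : weight i = q * weight i.+1 ^+ 2 / bot.
      by rewrite -wr; field; rewrite gt_eqF.
    by field; rewrite !gt_eqF.
  set v := weight i.+1; set w := weight i; set m := M i.+1; set y := d i.+1.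
  have wm : 0 < w * mu i.+1 := mulr_gt0 w0 m0.
  rewrite ler_pdivlMr// => h.
  have := ler_wpM2r (ltW wm) h.
  have := sqr_ge0 (w * mu i.+1 * y - 14 / 3 * v * m).
  by lra.
have sumstage := ler_sum_nat (fun i (h : (0 <= i < N)%N) => stage i h).
(* The factor 40 of [Qbar] enters here: 98/9 is at most 40 times 7/25. *)
have bq : 98 / 9 * (bot / q) * (\sum_(1 <= i < N.+1) (M i ^+ 2 / mu i)) <=
    bot * (7 / 25 * eps).
  have e0 : 0 <= q * eps.
    apply: le_trans Qeps; rewrite mulr_ge0// big_nat sumr_ge0// => i /andP[i1 iN].
    by rewrite divr_ge0 ?sqr_ge0// ltW// mu0// i1 ltnW.
  have : 0 <= bot / q by rewrite divr_ge0 ?ltW.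
  move=> /(ler_wpM2l)/(_ _ _ Qeps).
  have -> : bot / q * (q * eps) = bot * eps by field; rewrite gt_eqF.
  have : 0 <= bot * eps by rewrite mulr_ge0 ?(ltW b0)// -(pmulr_rge0 _ q0).
  by lra.
apply: (@le_trans _ _ (\sum_(0 <= i < N.+1) (th * (weight i * P i)
    - th * (weight i * (mu i.+1 / 2 * d i.+1 ^+ 2))
    + th * (weight i * (2 * M i * d i)) + th * bot * (weight i * D i)))).
  rewrite !big_nat; apply: ler_sum => i /andP[_ iN].
  have := ler_wpM2l (ltW (weight_gt0 i)) (PP' i iN); rewrite -/th thE.
  by lra.
rewrite !big_split/= sumrN -!mulr_sumr -/th thE sumM.
move: sumstage; rewrite sumrB big_split/= -!mulr_sumr.
move: bq; rewrite big_add1/=.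
rewrite -mulr_sumr in sumD; move: sumD summu.
set sM := \sum_(0 <= i < N) 2 * M i.+1 * d i.+1.
set sw := \sum_(0 <= i < N) weight i.+1 * _; set sm := \sum_(0 <= i < N) weight i * _.
set sD := \sum_(0 <= i < N.+1) _ * D i; set sP := \sum_(0 <= i < N.+1) _ * P i.
set sm' := \sum_(0 <= i < N.+1) weight i * _; set sq := \sum_(0 <= i < N) _.
move=> sumD summu bq sumstage.
have bD := ler_wpM2l (ltW b0) sumD.
have : bot * sD + sw - sm' <= bot * (7 / 25 * eps) by lra.
by move=> /(ler_wpM2l (ltW th0)); lra.
Qed.

End Weights.

(** * From contraction to an iteration count *)

(** The exponential of -1/6 is at least 5/6, so that of 1/6 is at most 6/5; then square. *)
Lemma ln_144_ge (R : realType) : 1 / 3 <= ln (36 / 25 : R).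
Proof.
rewrite -ler_expR lnK ?posrE; last by lra.
have -> : 1 / 3 = (1 / 6 + 1 / 6 : R) by field.
have h : expR (1 / 6 : R) <= 6 / 5.
  rewrite -[1 / 6]opprK expRN invf_ple ?posrE ?expR_gt0 ?divr_gt0//.
  by rewrite invf_div; apply: le_trans (expR_ge1Dx _); lra.
rewrite expRD; have := ler_pM (ltW (expR_gt0 _)) (ltW (expR_gt0 _)) h h.
by lra.
Qed.

(* The factor [36/25] gained inside the logarithm pays for one iteration, since
   [A * ln (36/25) >= 1]. *)
Lemma decay_count (R : realType) (A eps r : R) (Phi : nat -> R) (m : nat) :
  3 <= A -> 0 < eps -> Phi 0%N <= r ->
  (forall j, (j < m)%N -> Phi j.+1 <= (1 - A^-1) * Phi j + A^-1 * (7 / 25 * eps)) ->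
  eps < Phi m ->
  m.+1%:R <= A * ln (2 * r / eps).
Proof.
move=> A3 e0 Phi0 Phi_step ePhi; have A0 : 0 < A by apply: lt_le_trans A3; lra.
have th0 : 0 <= 1 - A^-1 by rewrite subr_ge0 invf_le1//; lra.
(* [7 / 25 * eps] is the fixed point of the recursion, so subtracting it leaves a geometric
   decay. *)
have decay j : (j <= m)%N ->
    Phi j - 7 / 25 * eps <= (1 - A^-1) ^+ j * (r - 7 / 25 * eps).
  elim: j => [_|j IH jm]; first by rewrite expr0 mul1r lerD2r.
  have := ler_wpM2l th0 (IH (ltnW jm)); rewrite mulrA -exprS => h.
  by apply: le_trans h; have := Phi_step j jm; lra.
have := decay m (leqnn m); set x := (1 - A^-1) ^+ m => xm.
have x0 : 0 <= x by rewrite exprn_ge0.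
have xexp : x <= expR (- (m%:R / A)).
  rewrite -mulrN expRM_natl; apply: lerXn2r; rewrite ?nnegrE ?expR_ge0//.
  exact: expR_ge1Dx.
have xr : 18 / 25 * eps < x * r.
  have := mulr_ge0 x0 (ltW e0); move: xm ePhi; rewrite mulrBr; lra.
have r0 : 0 < r.
  rewrite ltNge; apply/negP => r0; have := mulr_ge0_le0 x0 r0.
  by move: xr e0; lra.
(* Doubling [xr] turns 18/25 into 36/25 and produces the factor 2 inside the logarithm. *)
have hexp : expR (m%:R / A) * (36 / 25) <= 2 * r / eps.
  rewrite ler_pdivlMr// -(ler_pM2l (expR_gt0 (- (m%:R / A)))).
  rewrite !mulrA -expRD addNr expR0 mul1r.
  by have := ler_wpM2r (ltW r0) xexp; move: xr; lra.
have : m%:R / A + 1 / 3 <= ln (2 * r / eps).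
  apply: le_trans (_ : m%:R / A + ln (36 / 25) <= _).
    by rewrite lerD2l ln_144_ge.
  have p : 0 < 36 / 25 :> R by rewrite divr_gt0.
  rewrite -[m%:R / A]expRK -lnM ?posrE ?expR_gt0// ler_ln// posrE.
    by rewrite mulr_gt0 ?expR_gt0.
  by rewrite divr_gt0// mulr_gt0.
move=> /(ler_wpM2l (ltW A0)); apply: le_trans.
rewrite -natr1 mulrDr mulrCA divff ?gt_eqF// mulr1.
by rewrite lerD2l; lra.
Qed.

(** * Stage value functions and their cuts *)

Section ValueFunctions.
Context {R : realType} {T : nat} {n : nat -> nat} {x0 : 'rV[R]_(n 0%N)}.
Context {X : forall t, set 'rV[R]_(n t)}.
Context {F : forall t, 'rV[R]_(n t) -> 'rV[R]_(n t.-1) -> R} {M : nat -> R}.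
Local Arguments X : clear implicits.
Local Arguments F : clear implicits.
Context (A0_init : X 0%N = [set x0]).
Context (A0 : forall t, (1 <= t <= T)%N ->
  [/\ X t !=set0, convex_set (X t) & compact (X t)]).
Context (A1 : forall t, (1 <= t <= T)%N ->
  convex_function setT
    (fun p : 'rV[R]_(n t) * 'rV[R]_(n t.-1) => F t p.1 p.2)).
Context (A3 : forall t, (1 <= t <= T)%N ->
  0 <= M t.-1 /\
  forall u v, X t u -> X t.-1 v ->
  forall s, subgradient (F t u) v s -> enorm s <= M t.-1).

Local Notation V := (approx_value X F).
Local Notation Q := (@cost_to_go R T n X F).
Local Notation cost := (@cost_from R T n F).

(** A real [inf] is a genuine infimum only for nonempty sets that are bounded below; this condition
    secures the second point. *)
Definition bounded_below_on {S : Type} (A : set S) (g : S -> R) :=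
  exists C, forall u, A u -> C <= g u.

Lemma lsc_bounded_below d (A : set 'rV[R]_d) (g : 'rV[R]_d -> R) :
  compact A -> lsc_on A g -> bounded_below_on A g.
Proof.
move=> cA lg; have [A0'|nA0] := pselect (A !=set0).
  by have [u [_ hu]] := lsc_argmin cA A0' lg; exists (g u).
by exists 0 => u Au; exfalso; apply: nA0; exists u.
Qed.

Lemma X_nonempty t : (t <= T)%N -> X t !=set0.
Proof.
by case: t => [_|t tT]; [rewrite A0_init; exists x0|have [] := A0 (t := t.+1) tT].
Qed.

Lemma X_compact t : (t <= T)%N -> compact (X t).
Proof.
by case: t => [_|t tT]; [rewrite A0_init; exact: compact_set1|have [] := A0 (t := t.+1) tT].
Qed.

Lemma M_ge0 t : (t < T)%N -> 0 <= M t.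
Proof. by move=> tT; have [] := A3 (t := t.+1) tT. Qed.

Lemma F_convex_l t v : (t < T)%N -> convex_ineq (fun u => F t.+1 u v).
Proof.
move=> tT u u' a a01.
have /= := convex_function_le (A1 (t := t.+1) tT) (I : setT (u, v)) (I : setT (u', v)) a01.
by rewrite -scalerDl [a + _]addrC subrK scale1r.
Qed.

Lemma F_convex_r t u : (t < T)%N -> convex_ineq (F t.+1 u).
Proof.
move=> tT v v' a a01.
have /= := convex_function_le (A1 (t := t.+1) tT) (I : setT (u, v)) (I : setT (u, v')) a01.
by rewrite -scalerDl [a + _]addrC subrK scale1r.
Qed.

Lemma F_lipschitz t u v v' : (t < T)%N -> X t.+1 u -> X t v ->
  F t.+1 u v <= F t.+1 u v' + M t * enorm (v' - v).
Proof.
move=> tT Xu Xv; apply: (@subgradient_lipschitz _ _ (X t)) => //.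
  exact: F_convex_r.
by move=> w s Xw; have [_] := A3 (t := t.+1) tT; exact.
Qed.

Lemma F_lsc t v : (t < T)%N -> lsc_on (X t.+1) (fun u => F t.+1 u v).
Proof. by move=> tT; apply: convex_lsc_on; exact: F_convex_l. Qed.

(** A lower bound at one state [v0] carries over to all states of the bounded set [X t] through
    [F_lipschitz]. *)
Lemma F_bounded_below t : (t < T)%N ->
  exists C, forall u v, X t.+1 u -> X t v -> C <= F t.+1 u v.
Proof.
move=> tT; have [v0 Xv0] := X_nonempty (ltnW tT).
have [C hC] := compact_enorm_bounded v0 (X_compact (ltnW tT)).
have [c hc] := lsc_bounded_below (X_compact tT) (F_lsc (v := v0) tT).
exists (c - M t * C) => u v Xu Xv.
have := F_lipschitz v tT Xu Xv0; have := hc u Xu.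
by have := ler_wpM2l (M_ge0 tT) (hC v Xv); lra.
Qed.

Section ApproxValue.
Context {t : nat} (tT : (t < T)%N) (g : 'rV[R]_(n t.+1) -> R).

Lemma approx_value_le u v : bounded_below_on (X t.+1) g -> X t.+1 u ->
  V g v <= F t.+1 u v + g u.
Proof.
move=> [c hc] Xu; apply: ge_inf; last by exists u.
have [C hC] := lsc_bounded_below (X_compact tT) (F_lsc (v := v) tT).
by exists (C + c) => _ [w Xw <-]; apply: lerD; [exact: hC|exact: hc].
Qed.

Lemma approx_value_ge v c : (forall u, X t.+1 u -> c <= F t.+1 u v + g u) ->
  c <= V g v.
Proof.
move=> h; apply: lb_le_inf; last by move=> _ [w Xw <-]; exact: h.
by have [u Xu] := X_nonempty tT; exists (F t.+1 u v + g u); exists u.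
Qed.

Lemma approx_value_argmin u v : argmin (X t.+1) (stage_obj F (t := t.+1) v g) u ->
  V g v = F t.+1 u v + g u.
Proof.
move=> [Xu hu]; apply/eqP; rewrite eq_le; apply/andP; split.
  by apply: ge_inf; [exists (F t.+1 u v + g u) => _ [w Xw <-]; exact: hu|exists u].
by apply: approx_value_ge => w; exact: hu.
Qed.

Lemma approx_value_lipschitz v v' : bounded_below_on (X t.+1) g ->
  X t v -> V g v <= V g v' + M t * enorm (v' - v).
Proof.
move=> bg Xv; rewrite -lerBlDr; apply: approx_value_ge => u Xu.
have := approx_value_le v bg Xu; have := F_lipschitz v' tT Xu Xv.
by lra.
Qed.

(* A subgradient of [V g] at [v] is one of [F t.+1 u] for the minimizer [u], to
   which the bound (A3) applies. *)
Lemma approx_value_subgradient v s : lsc_on (X t.+1) g -> X t v ->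
  subgradient (V g) v s -> enorm s <= M t.
Proof.
move=> lg Xv hs; have bg := lsc_bounded_below (X_compact tT) lg.
have [u argu] : exists u, argmin (X t.+1) (stage_obj F (t := t.+1) v g) u.
  apply: lsc_argmin; [exact: X_compact|exact: X_nonempty|].
  by apply: lsc_onD => //; exact: F_lsc.
have [_ hM] := A3 (t := t.+1) tT; apply: (hM u v) => //; first by case: argu.
move=> z; have := hs z; rewrite (approx_value_argmin argu).
have Xu : X t.+1 u by case: argu.
by have := approx_value_le z bg Xu; lra.
Qed.

(** One multiple of [M t] comes from the Lipschitz bound on [V g], the other from the slope of the
    cut. *)
Lemma cut_lipschitz v v' l : lsc_on (X t.+1) g -> X t v -> X t v' ->
  is_cut X F g v l -> V g v' <= l v' + 2 * M t * enorm (v' - v).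
Proof.
move=> lg Xv Xv' [s hs ->].
have bg := lsc_bounded_below (X_compact tT) lg.
have := approx_value_lipschitz v bg Xv'; rewrite -opprB enormN.
have := ler_wpM2r (enorm_ge0 (v' - v)) (approx_value_subgradient lg Xv hs).
have := dotv_le_enorm s (v - v'); rewrite -[v - v']opprB dotvNr enormN.
by lra.
Qed.

End ApproxValue.

(** * Tail costs and the exact cost-to-go functions *)

Lemma cost_from_recl t (u : forall s, 'rV[R]_(n s)) : (t < T)%N ->
  cost t u = F t.+1 (u t.+1) (u t) + cost t.+1 u.
Proof. by move=> tT; rewrite /cost_from big_ltn. Qed.

Lemma cost_from_T (u : forall s, 'rV[R]_(n s)) : cost T u = 0.
Proof. by rewrite /cost_from big_geq. Qed.

Lemma stage_ind (P : nat -> Prop) : P T ->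
  (forall t, (t < T)%N -> P t.+1 -> P t) -> forall t, (t <= T)%N -> P t.
Proof.
move=> PT PS t tT; rewrite -(subKn tT).
elim: (T - t)%N (leq_subr t T) => [|k IH] kT; first by rewrite subn0.
have h : (T - k.+1).+1 = (T - k)%N by rewrite subnSK.
by apply: PS; rewrite h ?leq_subr//; apply: IH; exact: ltnW.
Qed.

Definition admissible t (u : forall s, 'rV[R]_(n s)) :=
  forall s, (t <= s <= T)%N -> X s (u s).

Lemma admissibleS t u : admissible t u -> admissible t.+1 u.
Proof. by move=> au s /andP[ts sT]; apply: au; rewrite (ltnW ts). Qed.

Lemma admissible_ex t v : (t <= T)%N -> X t v -> exists2 u, admissible t u & u t = v.
Proof.
move=> tT Xv.
have [w Xw] : exists w : forall s, 'rV[R]_(n s), forall s, (s <= T)%N -> X s (w s).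
  by exists (fun s => xget 0 (X s)) => s /X_nonempty; exact: xgetPex.
(* The type of an entry depends on its index, so [v] is transported along the proof that [t] equals
   [s]. *)
exists (fun s => if t =P s is ReflectT e then eq_rect t (fun s => 'rV[R]_(n s)) v s e
                 else w s).
  move=> s /andP[_ sT]; case: eqP => [e|_]; last exact: Xw.
  by case: _ / e.
by case: eqP => // e; rewrite eq_axiomK.
Qed.

Lemma cost_bounded_below t : (t <= T)%N ->
  exists C, forall u, admissible t u -> C <= cost t u.
Proof.
move: t; apply: stage_ind; first by exists 0 => u _; rewrite cost_from_T.
move=> t tT [C hC]; have [c hc] := F_bounded_below tT.
exists (c + C) => u au; rewrite cost_from_recl//; apply: lerD.
  by apply: hc; apply: au; rewrite ?leqnn ?leqnSn ?(ltnW tT) ?tT.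
by apply: hC; exact: admissibleS.
Qed.

Lemma cost_to_go_le t u : (t <= T)%N -> admissible t u -> Q (u t) <= cost t u.
Proof.
move=> tT au; have Xt : X t (u t) by apply: au; rewrite leqnn.
apply: ge_inf; last by exists u => //; split=> // s /andP[/ltnW ts sT]; apply: au; rewrite ts.
have [C hC] := cost_bounded_below tT; exists C => _ [w [wt Xw] <-].
apply: hC => s /andP[]; rewrite leq_eqVlt => /predU1P[<- _|ts sT].
  by rewrite wt.
by apply: Xw; rewrite ts.
Qed.

Lemma cost_to_go_ge t v c : (t <= T)%N -> X t v ->
  (forall u, admissible t u -> u t = v -> c <= cost t u) -> c <= Q v.
Proof.
move=> tT Xv h; apply: lb_le_inf.
  have [u au ut] := admissible_ex tT Xv; exists (cost t u); exists u => //.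
  by split=> // s /andP[/ltnW ts sT]; apply: au; rewrite ts.
move=> _ [w [wt Xw] <-]; apply: h => // s /andP[].
rewrite leq_eqVlt => /predU1P[<- _|ts sT]; first by rewrite wt.
by apply: Xw; rewrite ts.
Qed.

Lemma cost_to_go_bounded_below t : (t <= T)%N -> bounded_below_on (X t) (@Q t).
Proof.
move=> tT; have [C hC] := cost_bounded_below tT; exists C => v Xv.
by apply: cost_to_go_ge => // u au _; exact: hC.
Qed.

Definition minorant t (g : 'rV[R]_(n t) -> R) :=
  lsc_on (X t) g /\ forall u, X t u -> g u <= Q u.

(** Half of the Bellman equation: split off the first stage of an admissible tuple and bound [g] by
    the cost of the rest. *)
Lemma approx_value_le_cost_to_go t g v : (t < T)%N -> @minorant t.+1 g -> X t v ->
  V g v <= Q v.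
Proof.
move=> tT [lg gQ] Xv; apply: cost_to_go_ge; [exact: ltnW|by []|].
move=> u au ut; rewrite cost_from_recl// ut.
have Xu : X t.+1 (u t.+1) by apply: au; rewrite leqnSn.
have := approx_value_le tT v (lsc_bounded_below (X_compact tT) lg) Xu.
have := cost_to_go_le tT (admissibleS au); have := gQ _ Xu.
by lra.
Qed.

Lemma approx_value_mono t g h v : (t < T)%N -> bounded_below_on (X t.+1) g ->
  (forall u, X t.+1 u -> g u <= h u) -> @approx_value R n X F t g v <= V h v.
Proof.
move=> tT bg gh; apply: approx_value_ge => // u Xu.
by have := approx_value_le tT v bg Xu; have := gh u Xu; lra.
Qed.

Lemma cut_minorant t g v l : (t < T)%N -> @minorant t.+1 g ->
  is_cut X F g v l -> @minorant t l.
Proof.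
move=> tT mg [s hs hl]; split; last first.
  move=> u Xu; rewrite hl; apply: le_trans (hs u) _.
  exact: approx_value_le_cost_to_go.
apply: (@lsc_on_eq _ _ _ (fun u => V g v + dotv s (u - v))) => [u _|].
  by rewrite hl.
apply: convex_lsc_on => u w a _; rewrite !dotvDr !dotvZr; lra.
Qed.

Lemma zero_minorant g : (forall u, X T u -> g u = 0) -> @minorant T g.
Proof.
move=> g0; split.
  apply: (@lsc_on_eq _ _ _ (fun=> 0)) => [u Xu|]; first by rewrite g0.
  by apply: convex_lsc_on => u w a _; rewrite !mulr0 addr0.
move=> u Xu; rewrite g0//; apply: cost_to_go_ge => // w _ _.
by rewrite cost_from_T.
Qed.

Lemma minorant_max t g h f : @minorant t g -> @minorant t h ->
  (forall u, X t u -> f u = Num.max (g u) (h u)) -> minorant f.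
Proof.
move=> [lg gQ] [lh hQ] fE; split.
  apply: lsc_on_eq (lsc_on_max lg lh) => u Xu.
  by rewrite fE.
by move=> u Xu; rewrite fE// ge_max gQ// hQ.
Qed.


(** * Invariants along a run *)

Section Run.
Context {mu : nat -> R} {eps : R} {x y : nat -> forall t, 'rV[R]_(n t)}.
Context {Gam : nat -> forall t, 'rV[R]_(n t) -> R}.
Local Arguments Gam : clear implicits.
Context (hT : (0 < T)%N).
Context (A2 : forall t, (1 <= t <= T)%N ->
  0 < mu t /\
  forall v, X t.-1 v -> strongly_convex (mu t) (fun u => F t u v)).
Context (hrun : fddp_run T X F x0 eps x y Gam).

Local Notation performed := (performed T X F x0 eps y Gam).
Local Notation gap := (gap T X F x0 y Gam).

Lemma performed1 : performed 1.
Proof. by split=> // j /andP[j0]; rewrite ltnS leqNgt j0. Qed.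

Lemma performed_le j k : (0 < j <= k)%N -> performed k -> performed j.
Proof.
move=> /andP[j0 jk] [_ hp]; split=> // i /andP[i0 ij].
by apply: hp; rewrite i0 (leq_trans ij).
Qed.

Lemma performed_pred k : performed k.+2 -> performed k.+1 /\ eps < gap k.+1.
Proof.
move=> [_ hp]; split; last by apply: hp; rewrite ltnSn.
by split=> // j /andP[j0 jk]; apply: hp; rewrite j0 ltnW.
Qed.

Lemma iterate_forward k : performed k -> fddp_forward T X F x0 x y Gam k.
Proof. by move=> /(hrun.2)[]. Qed.

Lemma iterate_admissible k : performed k -> admissible 0 (x k).
Proof.
move=> /iterate_forward[xk0 argx _] [|t] /= tT; first by rewrite xk0 A0_init.
by have [] := argx t.+1 tT.
Qed.

Lemma iterate_mem k t : performed k -> (t <= T)%N -> X t (x k t).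
Proof. by move=> /iterate_admissible + tT; apply. Qed.

Lemma incumbent_mem k t : performed k -> (0 < t <= T)%N -> X t (y k t).
Proof.
move=> + tT; elim: k => [|k IH] pk; first by case: pk.
have [_ _ ->] := iterate_forward pk; case: ifP => _ /=; last first.
  by apply: iterate_mem => //; case/andP: tT.
case: k pk IH => [_ _|k /performed_pred[pk _] IH]; last exact: IH.
by have [[[_ h] -> _ _] _] := hrun; exact: h.
Qed.

Lemma Gam_last k u : performed k -> X T u -> Gam k T u = 0.
Proof.
case: k => [|[|k]]; first by case.
  by move=> _; have [[_ _ h _] _] := hrun; exact: h.
by move=> /performed_pred[pk ek]; have [_ /(_ ek)[h _]] := hrun.2 _ pk; exact: h.
Qed.

(** Within one iteration, go backwards over the stages: a cut inherits minorization from the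
    function at [t.+1], and a shadow is a minorant by definition. *)
Lemma Gam_minorant k t : performed k -> (0 < t <= T)%N -> minorant (Gam k t).
Proof.
elim: k t => [|[|k] IH] t pk; first by case: pk.
  move=> /andP[t0 tT]; move: t tT t0; apply: stage_ind.
    by move=> _; apply: zero_minorant => u; exact: Gam_last.
  move=> t tT IHt t0; have [[_ _ _ hcut] _] := hrun.
  by apply: (cut_minorant tT (IHt isT) (hcut t _)); rewrite t0.
have [pk' ek] := performed_pred pk.
move=> /andP[t0 tT]; move: t tT t0; apply: stage_ind.
  by move=> _; apply: zero_minorant => u; exact: Gam_last.
move=> t tT IHt t0; have [_ /(_ ek)[_ hb]] := hrun.2 _ pk'.
have [|l [gb [hl [_ [_ lgb gbQ] _ _] hmax]]] := hb t; first by rewrite t0.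
apply: (@minorant_max t l gb) => //.
exact: (cut_minorant tT (IHt isT) hl).
Qed.

(** These are m_t, D_t and d_t of the overview; [move_dist k] compares the iterates [k] and
    [k.+1]. *)
Definition lower k t : R := V (Gam k t.+1) (x k t).
Definition stage_gap k t : R := cost t (x k) - lower k t.
Definition move_dist k t : R := enorm (x k.+1 t - x k t).

Lemma move_dist_ge0 k t : 0 <= move_dist k t.
Proof. exact: enorm_ge0. Qed.

Lemma lowerE k t : performed k -> (t < T)%N ->
  lower k t = F t.+1 (x k t.+1) (x k t) + Gam k t.+1 (x k t.+1).
Proof.
move=> /iterate_forward[_ argx _] tT.
exact: approx_value_argmin (argx t.+1 tT).
Qed.

Lemma stage_gapE k t : performed k -> (t < T)%N ->
  stage_gap k t = cost t.+1 (x k) - Gam k t.+1 (x k t.+1).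
Proof.
move=> pk tT; rewrite /stage_gap lowerE// cost_from_recl//; ring.
Qed.

Lemma stage_gap_last k : performed k -> stage_gap k T.-1 = 0.
Proof.
move=> pk; have TE : T.-1.+1 = T by rewrite prednK.
rewrite stage_gapE ?TE// cost_from_T Gam_last ?subrr//.
exact: iterate_mem.
Qed.

(** The new approximation dominates the cut made at the previous iterate, and [cut_lipschitz]
    measures the error of that cut at the new one. *)
Lemma stage_gap_le k t : performed k.+2 -> (t.+1 < T)%N ->
  stage_gap k.+2 t <= stage_gap k.+2 t.+1 + 2 * M t.+1 * move_dist k.+1 t.+1.
Proof.
move=> pk tT; have [pk' ek] := performed_pred pk.
have [_ /(_ ek)[_ hb]] := hrun.2 _ pk'.
have [|l [gb [hl _ hmax]]] := hb t.+1; first exact: tT.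
have Xx := iterate_mem pk (ltnW tT); have Xx' := iterate_mem pk' (ltnW tT).
have [lG _] := Gam_minorant pk (tT : 0 < t.+2 <= T)%N.
have := cut_lipschitz tT lG Xx' Xx hl.
rewrite stage_gapE 1?ltnW// hmax// /stage_gap -/(lower k.+2 t.+1) => h.
have : l (x k.+2 t.+1) <= Num.max (l (x k.+2 t.+1)) (gb (x k.+2 t.+1)).
  by rewrite le_max lexx.
by rewrite /move_dist; lra.
Qed.

(* Shadows keep the minimizer of the previous stage problem, so that strong
   convexity applies there. *)
Lemma lower_growth k t : performed k.+2 -> (t < T)%N ->
  lower k.+1 t + mu t.+1 / 2 * move_dist k.+1 t.+1 ^+ 2
    - M t * move_dist k.+1 t <= lower k.+2 t.
Proof.
move=> pk tT; have [pk' ek] := performed_pred pk.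
have Xv := iterate_mem pk (ltnW tT); have Xv' := iterate_mem pk' (ltnW tT).
have Xu := iterate_mem pk tT.
(* [g] is the shadow when [t.+1 < T], and zero at the last stage, where all approximations vanish on
   [X T]. *)
have [g [cg gE gle argg]] : exists g, [/\ convex_function (X t.+1) g,
    g (x k.+1 t.+1) = Gam k.+1 t.+1 (x k.+1 t.+1),
    g (x k.+2 t.+1) <= Gam k.+2 t.+1 (x k.+2 t.+1) &
    argmin (X t.+1) (stage_obj F (t := t.+1) (x k.+1 t) g) (x k.+1 t.+1)].
  have [_ argx _] := iterate_forward pk'; have argk := argx t.+1 tT.
  have [tT'|Tt] := ltnP t.+1 T.
    have [_ /(_ ek)[_ hb]] := hrun.2 _ pk'.
    have [|l [gb [_ [_ [cgb _ _] gbE argb] hmax]]] := hb t.+1; first exact: tT'.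
    by exists gb; split=> //; rewrite hmax// le_max lexx orbT.
  have TE : t.+1 = T by apply/eqP; rewrite eqn_leq tT Tt.
  have G0 j u : performed j -> X t.+1 u -> Gam j t.+1 u = 0.
    by move: u; rewrite TE => u; exact: Gam_last.
  have Xu' := iterate_mem pk' tT.
  exists (fun=> 0); split; rewrite ?G0//.
    by move=> a u v _ _; rewrite convRE !mulr0 addr0.
  case: argk => _ hk; split=> // u Xw; have := hk u Xw.
  by rewrite /stage_obj !G0.
have [[mu0 sF] [_ cX _]] := (A2 (t := t.+1) tT, A0 (t := t.+1) tT).
(* Growth is obtained at the old state [x k.+1 t]; passing to the new state costs the Lipschitz
   term. *)
have := argmin_growth cX (sF _ Xv') cg argg Xu.
have := F_lipschitz (x k.+2 t) tT Xu Xv'.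
by rewrite !lowerE// gE /move_dist; lra.
Qed.

(** * Averaged upper bounds and their gaps *)

Section Averages.
Context {a : R} (a01 : 0 <= a <= 1).

(* The terms in [move_dist] keep the average above the true value function as the
   iterate moves. *)
Fixpoint upper (j t : nat) : R :=
  if j is i.+1 then
    (1 - a) * (upper i t + M t * move_dist i.+1 t) + a * cost t (x i.+2)
  else cost t (x 1%N).

(** P_t of the overview at iterate [j.+1]: iterations are numbered from 1, averages from 0. *)
Definition averaged_gap j t : R := upper j t - lower j.+1 t.

(** One term [M t * move_dist j.+1 t] comes from the update of [upper], the other from
    [lower_growth]. *)
Lemma averaged_gap_step j t : performed j.+2 -> (t < T)%N ->
  averaged_gap j.+1 t <= (1 - a) * (averaged_gap j t
    - mu t.+1 / 2 * move_dist j.+1 t.+1 ^+ 2 + 2 * M t * move_dist j.+1 t)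
    + a * stage_gap j.+2 t.
Proof.
move=> pj tT; have := lower_growth pj tT.
have b0 : 0 <= 1 - a by case/andP: a01; rewrite subr_ge0.
move=> /(ler_wpM2l b0); rewrite /averaged_gap /stage_gap /=.
by lra.
Qed.

(** The value built from [Q] is Lipschitz, so the correction in [upper] pays for the move to the new
    iterate; the fresh cost dominates that value by feasibility. *)
Lemma cost_to_go_approx_le_upper j t : performed j.+1 -> (t < T)%N ->
  V (@Q t.+1) (x j.+1 t) <= upper j t.
Proof.
have Qcost k : performed k -> (t < T)%N -> V (@Q t.+1) (x k t) <= cost t (x k).
  move=> pk tT; have Xu := iterate_mem pk tT.
  apply: le_trans (approx_value_le tT _ (cost_to_go_bounded_below tT) Xu) _.
  rewrite cost_from_recl// lerD2l; apply: cost_to_go_le => // s /andP[_].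
  exact: iterate_mem.
elim: j => [|j IH] pj tT; first exact: Qcost.
have [pj' _] := performed_pred pj; have /andP[a0 a1] := a01.
have hl := approx_value_lipschitz tT (x j.+1 t) (cost_to_go_bounded_below tT)
  (iterate_mem pj (ltnW tT)).
rewrite -opprB enormN -/(move_dist j.+1 t) in hl.
have b0 : 0 <= 1 - a by rewrite subr_ge0.
have h1 := ler_wpM2l b0 (le_trans hl (lerD (IH pj' tT) (lexx _))).
have h2 := ler_wpM2l a0 (Qcost _ pj tT).
by move: h1 h2 => /=; lra.
Qed.

Lemma averaged_gap_ge0 j t : performed j.+1 -> (t < T)%N -> 0 <= averaged_gap j t.
Proof.
move=> pj tT; rewrite subr_ge0; apply: le_trans (cost_to_go_approx_le_upper pj tT).
have [lG GQ] := Gam_minorant pj (tT : 0 < t.+1 <= T)%N.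
by apply: approx_value_mono => //; apply: lsc_bounded_below (X_compact tT) lG.
Qed.

(** All iterates share the state [x0] at stage 0, so there [upper] is a convex average of costs,
    none below that of the incumbent. *)
Lemma gap_le_averaged_gap j : performed j.+1 -> gap j.+1 <= averaged_gap j 0.
Proof.
move=> pj; have [x00 _ _] := iterate_forward pj.
rewrite /Defs.gap /averaged_gap /lower x00 lerD2r.
elim: j pj {x00} => [|j IH] pj.
  have [_ _ ->] := iterate_forward pj; case: ifP => //.
have [pj' _] := performed_pred pj; have /andP[a0 a1] := a01.
have [x0j _ yE] := iterate_forward pj; have [x0j' _ _] := iterate_forward pj'.
have -> : upper j.+1 0 = (1 - a) * upper j 0 + a * cost 0 (x j.+2).
  by rewrite /= /move_dist x0j x0j' subrr enorm0 mulr0 addr0.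
have b0 : 0 <= 1 - a by rewrite subr_ge0.
have := ler_wpM2l b0 (IH pj').
rewrite yE /=; case: (leP (cost 0 (y j.+1)) (cost 0 (x j.+2))) => [h|h].
  by have := ler_wpM2l a0 h; lra.
by have := ler_wpM2l b0 (ltW h); lra.
Qed.

Lemma initial_averaged_gap_sum (U L w : nat -> R) :
  (forall t, (2 <= t <= T)%N ->
    0 <= U t /\ forall u v, X t u -> X t.-1 v -> F t u v <= U t) ->
  (forall t, (1 <= t <= T - 1)%N ->
    L t < 0 /\ forall u, X t u -> L t <= Gam 1%N t u) ->
  (forall i, 0 <= w i <= 1) -> \sum_(0 <= i < T.-1) w i <= 4 / 3 ->
  \sum_(0 <= i < T.-1.+1) w i * averaged_gap 0 i <=
    2 * (\sum_(2 <= t < T.+1) U t) - \sum_(1 <= t < T) L t.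
Proof.
move=> hU hL w01 sw; have p1 := performed1.
set S := \sum_(2 <= t < T.+1) U t.
have S0 : 0 <= S.
  by rewrite /S big_nat sumr_ge0// => t /andP[t2 tT]; have [] := hU t; rewrite ?t2.
have costS t : (0 < t < T)%N -> cost t (x 1%N) <= S.
  move=> /andP[t0 tT]; rewrite /S (@big_cat_nat _ _ _ t.+1)//=; last exact: ltnW.
  apply: (@le_trans _ _ (\sum_(t.+1 <= s < T.+1) U s)).
    rewrite /cost_from !big_nat; apply: ler_sum => s /andP[ts sT].
    have s0 : (0 < s)%N by apply: leq_ltn_trans ts.
    have [|_] := hU s; first by rewrite -ltnS in sT *; rewrite (leq_ltn_trans t0 ts).
    apply; first exact: (iterate_mem p1).
    by apply: (iterate_mem p1); apply: leq_trans (leq_pred _) _.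
  rewrite lerDr big_nat sumr_ge0// => s /andP[s2 st]; have [] := hU s => //.
  by rewrite s2/= -ltnS (leq_trans st)// ltnS ltnW.
(* The gap of the last stage vanishes; the other weights sum to at most 4/3, within the factor 2
   allowed for [S]. *)
rewrite big_nat_recr//= [averaged_gap 0 _]stage_gap_last// mulr0 addr0.
have -> : \sum_(1 <= t < T) L t = \sum_(0 <= i < T.-1) L i.+1.
  by rewrite big_add1.
apply: (@le_trans _ _ (\sum_(0 <= i < T.-1) (w i * S - L i.+1))).
  rewrite !big_nat; apply: ler_sum => i /andP[_ iT].
  have iT' : (i.+1 < T)%N by rewrite -ltn_predRL.
  rewrite [averaged_gap 0 i]stage_gapE; [|by []|exact: ltnW].
  have [|L0 hLi] := hL i.+1; first by rewrite subn1.
  have := costS i.+1 iT'; have := hLi _ (iterate_mem p1 (ltnW iT')).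
  have /andP[w0 w1] := w01 i; move=> h1 h2.
  have h3 : cost i.+1 (x 1%N) - Gam 1%N i.+1 (x 1%N i.+1) <= S - L i.+1 by lra.
  have := ler_wpM2l w0 h3; have : 0 <= (1 - w i) * - L i.+1.
    by rewrite mulr_ge0 ?subr_ge0// oppr_ge0 ltW.
  by lra.
rewrite sumrB -mulr_suml; have := ler_wpM2r S0 sw; lra.
Qed.

End Averages.
End Run.
End ValueFunctions.

(** * Choice of the parameters and final count *)

Theorem theorem2p3 (R : realType) (T : nat) (n : nat -> nat)
  (x0 : 'rV[R]_(n 0%N)) (X : forall t, set 'rV[R]_(n t))
  (F : forall t, 'rV[R]_(n t) -> 'rV[R]_(n t.-1) -> R)
  (mu M : nat -> R)
  (hT : (2 <= T)%N)
  (A0_init : X 0%N = [set x0])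
  (A0 : forall t, (1 <= t <= T)%N ->
    [/\ X t !=set0, convex_set (X t) & compact (X t)])
  (A1 : forall t, (1 <= t <= T)%N ->
    convex_function setT
      (fun p : 'rV[R]_(n t) * 'rV[R]_(n t.-1) => F t p.1 p.2))
  (A2 : forall t, (1 <= t <= T)%N ->
    0 < mu t /\
    forall v, X t.-1 v -> strongly_convex (mu t) (fun u => F t u v))
  (A3 : forall t, (1 <= t <= T)%N ->
    0 <= M t.-1 /\
    forall u v, X t u -> X t.-1 v ->
    forall s, subgradient (F t u) v s -> enorm s <= M t.-1)
  (eps : R) (heps : 0 < eps)
  (x y : nat -> forall t, 'rV[R]_(n t))
  (Gam : nat -> forall t, 'rV[R]_(n t) -> R)
  (hrun : fddp_run T X F x0 eps x y Gam)
  (U L : nat -> R)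
  (hU : forall t, (2 <= t <= T)%N ->
    0 <= U t /\ forall u v, X t u -> X t.-1 v -> F t u v <= U t)
  (hL : forall t, (1 <= t <= T - 1)%N ->
    L t < 0 /\ forall u, X t u -> L t <= Gam 1%N t u) :
  let rbar := 2 * (\sum_(2 <= t < T.+1) U t) - \sum_(1 <= t < T) L t in
  let Qbar := 40 * \sum_(1 <= t < T) (M t ^+ 2 / mu t) in
  exists K : nat,
    [/\ performed T X F x0 eps y Gam K,
        gap T X F x0 y Gam K <= eps,
        (forall t, (1 <= t <= T)%N -> X t (y K t)) &
        (* positive part of the logarithm: if [eps] exceeds [2 * rbar], one
           iteration is performed but [ln (2 * rbar / eps)] is negative *)
        K%:R <= (1 + Num.max 2 (Qbar / eps) ^+ (2 ^ (T - 1) - 1)) *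
                  Num.max 0 (ln (2 * rbar / eps)) + 1].
Proof.
move=> rbar Qbar; have T0 : (0 < T)%N by apply: leq_trans hT.
set q := Num.max 2 (Qbar / eps); have q2 : 2 <= q by rewrite le_max lexx.
pose N := T.-1; have NT : N.+1 = T by exact: prednK.
(* [A^-1] serves both as the averaging weight and as the contraction rate. *)
pose A : R := 1 + (bot N q)^-1.
have AE : A = 1 + q ^+ (2 ^ (T - 1) - 1) by rewrite /A /bot invrK /N [in RHS](subn1 T).
have A3' : 3 <= A.
  have : q <= q ^+ (2 ^ (T - 1) - 1).
    rewrite -[leLHS]expr1 ler_weXn2l//; first by apply: le_trans q2; lra.
    by rewrite subn_gt0 -[1%N](expn0 2) ltn_exp2l// subn_gt0.
  by rewrite AE; have := q2; lra.
have A0' : 0 < A by apply: lt_le_trans A3'; lra.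
have a01 : 0 <= A^-1 <= 1 by rewrite invr_ge0 ltW//= invf_le1//; lra.
pose P := @averaged_gap R T n X F M x Gam A^-1.
pose Phi j := \sum_(0 <= i < N.+1) weight N q i * P j i.
have w01 i : 0 <= weight N q i <= 1 by rewrite ltW ?weight_gt0// weight_le1.
have Phi0 : Phi 0%N <= rbar.
  apply: (initial_averaged_gap_sum A0_init A0 T0 hrun hU hL w01).
  exact: sum_weight_le.
have Qeps : 40 * \sum_(1 <= i < N.+1) (M i ^+ 2 / mu i) <= q * eps.
  by rewrite NT -ler_pdivrMr// le_max lexx orbT.
have Phi_step j : performed T X F x0 eps y Gam j.+2 ->
    Phi j.+1 <= (1 - A^-1) * Phi j + A^-1 * (7 / 25 * eps).
  move=> pj.
  apply: (@weighted_gap_step _ N q q2 (P j) (P j.+1)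
    (@stage_gap R T n X F x Gam j.+2) (@move_dist R n x j.+1) M mu eps) => //.
  - have [pj' _] := performed_pred pj.
    have [xj _ _] := iterate_forward hrun pj; have [xj' _ _] := iterate_forward hrun pj'.
    by rewrite /move_dist xj xj' subrr enorm0.
  - by move=> i; exact: move_dist_ge0.
  - by move=> i; rewrite -ltnS NT; exact: (M_ge0 A3).
  - by move=> i; rewrite NT => /A2[].
  - move=> i iN; apply: (stage_gap_le A0_init A0 A1 A3 hrun pj).
    by rewrite -NT ltnS.
  - by rewrite (stage_gap_last A0_init A0 T0 hrun pj).
  - move=> i; rewrite -ltnS NT => iT.
    exact: (averaged_gap_step A0_init A0 A1 A3 A2 hrun a01 pj iT).
have gapPhi j : performed T X F x0 eps y Gam j.+1 ->
    gap T X F x0 y Gam j.+1 <= Phi j.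
  move=> pj; apply: le_trans (gap_le_averaged_gap (M := M) hrun a01 pj) _.
  rewrite /Phi /P big_nat_recl//= weight0// mul1r lerDl big_nat sumr_ge0//.
  move=> i /andP[_ iN]; apply: mulr_ge0; first by have /andP[] := w01 i.+1.
  by apply: (averaged_gap_ge0 A0_init A0 A1 A3 hrun a01 pj); rewrite -NT ltnS.
(* [performed j.+2] says that the test failed at iteration [j.+1], whose gap is at most [Phi j]. *)
have count j : performed T X F x0 eps y Gam j.+2 ->
    j.+1%:R <= A * ln (2 * rbar / eps).
  move=> pj; have [pj' ej] := performed_pred pj.
  apply: (decay_count A3' heps Phi0); last exact: lt_le_trans ej (gapPhi _ pj').
  by move=> i ij; apply: Phi_step; apply: performed_le pj; rewrite !ltnS (ltnW ij).
have stop : exists k, (0 < k)%N && (gap T X F x0 y Gam k <= eps).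
  apply: contrapT => hno.
  have all_performed k : (0 < k)%N -> performed T X F x0 eps y Gam k.
    move=> k0; split=> // j /andP[j0 _]; rewrite ltNge; apply/negP => gj.
    by apply: hno; exists j; rewrite j0.
  (* An endless run would satisfy [count] for every [j], but for this one [j.+1] exceeds the
     bound. *)
  pose j := Num.truncn (A * ln (2 * rbar / eps)).
  have := count j (all_performed j.+2 isT).
  by rewrite leNgt truncnS_gt.
have [K /andP[K1 gK] minK] := ex_minnP stop.
have pK : performed T X F x0 eps y Gam K.
  split=> // j /andP[j0 jK]; rewrite ltNge; apply/negP => gj.
  by have := minK j; rewrite j0 gj leqNgt jK => /(_ isT).
exists K; split=> // [t tT|]; first exact: (incumbent_mem A0_init hrun pK).
(* For [K = 1] the nonnegative part of the logarithm suffices. For [K = j.+2], [count] bounds [j.+1]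
   and the final [+ 1] covers the stopping iteration. *)
rewrite -AE; case: K pK {K1 gK minK} => [|[|j]] pK; first by case: pK.
  by rewrite lerDr mulr_ge0 ?(ltW A0')// le_max lexx.
rewrite -natr1 lerD2r; apply: le_trans (count j pK) _.
by rewrite ler_pM2l// le_max lexx orbT.
Qed.
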